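(* Let $\Lambda$ be a ring and $\mathcal{Q}:\Lambda\text{-}\mathrm{Mod}\to\Lambda\text{-}\underline{\mathrm{Mod}}$ the quotient functor. The following are equivalent: (1) $\Lambda$ is left hereditary; (2) for every homomorphism $f:A\to B$ of $\Lambda$-modules, $f$ factors through a projective if and only if the corestriction $f:A\to f(A)$ does; (3) for every homomorphism $f:A\to B$ of $\Lambda$-modules, $\underline{f}$ is a monomorphism in the stable category if and only if the inclusion $\ker f:\mathrm{Ker}\, f\to A$ factors through a projective; (4) for every homomorphism $f:A\to B$ of $\Lambda$-modules, $\underline{f}$ is a monomorphism in the stable category if and only if the module $\mathrm{Ker}\, f$ is projective; (5) $\mathcal{Q}$ preserves monomorphisms; (6) for any $\Lambda$-module $X$, the functor $\underline{h}^{X}=\underline{\mathrm{Hom}}(X,\mathcal{Q}(-)):\Lambda\text{-}\mathrm{Mod}\to\mathrm{Ab}$ is left-exact; (7) $\mathcal{Q}$ preserves kernels; (8) $\mathcal{Q}$ preserves finite limits.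
   Context: Rings are associative with identity; modules are left modules. The stable category $\Lambda\text{-}\underline{\mathrm{Mod}}$ has all left $\Lambda$-modules as objects; its morphism group $\underline{\mathrm{Hom}}(A,B)$ is the quotient of $\mathrm{Hom}_\Lambda(A,B)$ by the subgroup of homomorphisms factoring through a projective module. The class of $f$ is denoted $\underline{f}$. The quotient functor $\mathcal{Q}$ is the identity on objects and sends $f$ to $\underline{f}$. $\ker f$ denotes the kernel morphism of $f$ and $\mathrm{Ker}\, f$ its domain. $\mathrm{Ab}$ is the category of abelian groups. *)

(* Defs.v *)
From HB Require Import structures.
From mathcomp Require Import all_boot ssralg generic_quotient ring_quotient.
From mathcomp Require Import boolp.

Set Implicit Arguments.
Unset Strict Implicit.
Unset Printing Implicit Defensive.

Import GRing.Theory.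
Import Quotient.
Local Open Scope ring_scope.
Local Open Scope quotient_scope.

(* [comp g f] is "g after f". *)
Record category := Category {
  obj :> Type;
  hom : obj -> obj -> Type;
  idmor : forall A, hom A A;
  comp : forall A B C, hom B C -> hom A B -> hom A C;
  comp1m : forall A B (f : hom A B), comp (idmor B) f = f;
  compm1 : forall A B (f : hom A B), comp f (idmor A) = f;
  compmA : forall A B C D (h : hom C D) (g : hom B C) (f : hom A B),
    comp h (comp g f) = comp (comp h g) f
}.
Arguments hom : clear implicits.
Arguments idmor {_} A.
Arguments comp {_ A B C} g f.

Record functor (C D : category) := Functor {
  fobj :> C -> D;
  fmap : forall A B, hom C A B -> hom D (fobj A) (fobj B);
  fmap1 : forall A, fmap (idmor A) = idmor (fobj A);
  fmapM : forall A1 A2 A3 (g : hom C A2 A3) (f : hom C A1 A2),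
    fmap (comp g f) = comp (fmap g) (fmap f)
}.
Arguments fmap {C D} F {A B} f : rename.

Section FunctorComp.
Variables (C D E : category) (G : functor D E) (F : functor C D).

Lemma fcomp1 A : fmap G (fmap F (idmor A)) = idmor (G (F A)).
Proof. by rewrite !fmap1. Qed.

Lemma fcompM A1 A2 A3 (g : hom C A2 A3) (f : hom C A1 A2) :
  fmap G (fmap F (comp g f)) = comp (fmap G (fmap F g)) (fmap G (fmap F f)).
Proof. by rewrite !fmapM. Qed.

Definition fcomp : functor C E :=
  @Functor C E (fun A => G (F A)) (fun A B f => fmap G (fmap F f)) fcomp1 fcompM.
End FunctorComp.

Definition monic (C : category) (A B : C) (f : hom C A B) : Prop :=
  forall (X : C) (u v : hom C X A), comp f u = comp f v -> u = v.

Definition zero_object (C : category) (Z : C) : Prop :=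
  forall X : C, (exists! f : hom C Z X, True) /\ (exists! f : hom C X Z, True).

(* In a category without zero object no morphism is zero; both Mod and StMod
   have one, and there the zero morphism is the zero of the Hom group. *)
Definition zero_morphism (C : category) (A B : C) (f : hom C A B) : Prop :=
  exists2 Z : C, zero_object Z &
    exists (u : hom C A Z) (v : hom C Z B), f = comp v u.

Definition is_kernel (C : category) (A B K : C) (f : hom C A B)
    (k : hom C K A) : Prop :=
  zero_morphism (comp f k) /\
  forall (X : C) (x : hom C X A), zero_morphism (comp f x) ->
    exists! u : hom C X K, comp k u = x.

(* The objects form a finType rather than an arbitrary finite [Type] so that
   the index categories of finite diagrams live in the universe of modules. *)
Record fincategory := FinCategory {
  fin_obj : finType;
  fin_hom : fin_obj -> fin_obj -> finType;
  fin_id : forall A, fin_hom A A;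
  fin_comp : forall A B C, fin_hom B C -> fin_hom A B -> fin_hom A C;
  fin_comp1m : forall A B (f : fin_hom A B), fin_comp (fin_id B) f = f;
  fin_compm1 : forall A B (f : fin_hom A B), fin_comp f (fin_id A) = f;
  fin_compmA : forall A B C D (h : fin_hom C D) (g : fin_hom B C)
    (f : fin_hom A B), fin_comp h (fin_comp g f) = fin_comp (fin_comp h g) f
}.

Definition category_of_fin (J : fincategory) : category :=
  @Category (fin_obj J) (@fin_hom J) (@fin_id J) (@fin_comp J)
    (@fin_comp1m J) (@fin_compm1 J) (@fin_compmA J).
Coercion category_of_fin : fincategory >-> category.

Record cone (J C : category) (D : functor J C) := Cone {
  apex : C;
  leg : forall j : J, hom C apex (D j);
  legE : forall (i j : J) (u : hom J i j), comp (fmap D u) (leg i) = leg j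
}.
Arguments apex {J C D} c.
Arguments leg {J C D} c j.

Definition is_limit (J C : category) (D : functor J C) (c : cone D) : Prop :=
  forall c' : cone D, exists! u : hom C (apex c') (apex c),
    forall j : J, comp (leg c j) u = leg c' j.

Section MapCone.
Variables (J C E : category) (F : functor C E) (D : functor J C) (c : cone D).

Lemma map_cone_subproof (i j : J) (u : hom J i j) :
  comp (fmap (fcomp F D) u) (fmap F (leg c i)) = fmap F (leg c j).
Proof. by rewrite /= -fmapM legE. Qed.

Definition map_cone : cone (fcomp F D) :=
  @Cone J E (fcomp F D) (F (apex c)) (fun j => fmap F (leg c j))
    map_cone_subproof.
End MapCone.

Section Preservation.
Variables (C D : category) (F : functor C D).

Definition preserves_monos : Prop :=
  forall (A B : C) (f : hom C A B), monic f -> monic (fmap F f).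

Definition preserves_kernels : Prop :=
  forall (A B K : C) (f : hom C A B) (k : hom C K A),
    is_kernel f k -> is_kernel (fmap F f) (fmap F k).

Definition preserves_finite_limits : Prop :=
  forall (J : fincategory) (G : functor J C) (c : cone G),
    is_limit c -> is_limit (map_cone F c).
End Preservation.

Lemma additive_eq (A B : zmodType) (f g : {additive A -> B}) :
  f =1 g -> f = g.
Proof.
move=> /funext; case: f => f [[f1]]; case: g => g [[g1]] /= fg.
by case: _ / fg g1 => g1; rewrite (Prop_irrelevance f1 g1).
Qed.

Definition Ab : category.
Proof.
refine (@Category zmodType (fun A B => {additive A -> B})
  (fun A => idfun : {additive A -> A})
  (fun A B C g f => g \o f : {additive A -> C}) _ _ _) => *; exact: additive_eq.
Defined.

Section Modules.
Variable R : pzRingType.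
Implicit Types A B C P : lmodType R.

Lemma linear_eq A B (f g : {linear A -> B}) : f =1 g -> f = g.
Proof.
move=> /funext; case: f => f [[f1] [f2]]; case: g => g [[g1] [g2]] /= fg.
case: _ / fg g1 g2 => g1 g2.
by rewrite (Prop_irrelevance f1 g1) (Prop_irrelevance f2 g2).
Qed.

Definition Mod : category.
Proof.
refine (@Category (lmodType R) (fun A B => {linear A -> B})
  (fun A => idfun : {linear A -> A})
  (fun A B C g f => g \o f : {linear A -> C}) _ _ _) => *; exact: linear_eq.
Defined.

Definition projective P : Prop :=
  forall A B (p : {linear A -> B}) (f : {linear P -> B}),
    (forall b, exists a, p a = b) ->
    exists g : {linear P -> A}, forall x, p (g x) = f x.

Definition factors_through_projective A B (f : {linear A -> B}) : Prop :=
  exists2 P : lmodType R, projective P &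
    exists (g : {linear A -> P}) (h : {linear P -> B}), forall a, f a = h (g a).

Definition submodule A (S : submodClosed A) : Type := {a : A | a \in S}.

Section Submodule.
Variables (A : lmodType R) (S : submodClosed A).
HB.instance Definition _ := SubChoice.on (submodule S).
HB.instance Definition _ := [SubChoice_isSubLmodule of submodule S by <:].
End Submodule.

(* Submodules of the regular left module R^o are the left ideals of R. *)
Definition left_hereditary : Prop :=
  forall I : submodClosed R^o, projective (submodule I).

Section KernelImage.
Variables (A B : lmodType R) (f : {linear A -> B}).

Definition ker_pred : {pred A} := fun a => f a == 0.
Definition im_pred : {pred B} := fun b => `[< exists a, f a = b >].

Lemma ker_pred_closed : submod_closed ker_pred.
Proof.
split=> [|r a b]; rewrite !unfold_in ?linear0 // => /eqP fa /eqP fb.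
by rewrite linearP fa fb scaler0 addr0.
Qed.
HB.instance Definition _ := GRing.isSubmodClosed.Build R A ker_pred ker_pred_closed.

Lemma im_pred_closed : submod_closed im_pred.
Proof.
split=> [|r x y]; first by apply/asboolP; exists 0; rewrite linear0.
move=> /asboolP[a <-] /asboolP[b <-]; apply/asboolP.
by exists (r *: a + b); rewrite linearP.
Qed.
HB.instance Definition _ := GRing.isSubmodClosed.Build R B im_pred im_pred_closed.

Definition Ker : lmodType R := submodule ker_pred.
Definition Im : lmodType R := submodule im_pred.

Definition ker : {linear Ker -> A} := \val.

Lemma im_subproof a : f a \in im_pred.
Proof. by apply/asboolP; exists a. Qed.

Definition corestriction_fun (a : A) : Im := exist _ (f a) (im_subproof a).

Lemma corestriction_is_linear : linear corestriction_fun.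
Proof. by move=> r a b; apply: val_inj; rewrite /= linearP. Qed.
HB.instance Definition _ :=
  GRing.isLinear.Build R A Im *:%R corestriction_fun corestriction_is_linear.

Definition corestriction : {linear A -> Im} := corestriction_fun.
End KernelImage.
End Modules.

Section HomGroup.
Variables (R : pzRingType) (A B : lmodType R).
Implicit Types f g h : {linear A -> B}.

HB.instance Definition _ := gen_eqMixin {linear A -> B}.
HB.instance Definition _ := gen_choiceMixin {linear A -> B}.

Definition linear_zero : {linear A -> B} := \0.
Definition linear_opp f : {linear A -> B} := \- f.
Definition linear_add f g : {linear A -> B} := f \+ g.

Lemma linear_addA : associative linear_add.
Proof. by move=> f g h; apply: linear_eq => a; rewrite /= addrA. Qed.
Lemma linear_addC : commutative linear_add.
Proof. by move=> f g; apply: linear_eq => a; rewrite /= addrC. Qed.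
Lemma linear_add0 : left_id linear_zero linear_add.
Proof. by move=> f; apply: linear_eq => a; rewrite /= add0r. Qed.
Lemma linear_addN : left_inverse linear_zero linear_opp linear_add.
Proof. by move=> f; apply: linear_eq => a; rewrite /= addNr. Qed.

HB.instance Definition _ := GRing.isZmodule.Build {linear A -> B}
  linear_addA linear_addC linear_add0 linear_addN.
End HomGroup.

Section Stable.
Variable R : pzRingType.
Implicit Types A B C D P Q X : lmodType R.

Lemma projective_ker_id A : projective (Ker (idfun : {linear A -> A})).
Proof.
move=> M N p f _; exists \0 => x; rewrite linear0.
suff -> : x = 0 by rewrite linear0.
by apply: val_inj; case: x => x /= /eqP.
Qed.

Section LinearPair.
Variables (A B C : lmodType R) (f : {linear A -> B}) (g : {linear A -> C}).

Definition linear_pair_fun (a : A) : (B * C)%type := (f a, g a).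

Lemma linear_pair_is_linear : linear linear_pair_fun.
Proof. by move=> r a b; rewrite /linear_pair_fun !linearP. Qed.
HB.instance Definition _ := GRing.isLinear.Build R A (B * C)%type *:%R
  linear_pair_fun linear_pair_is_linear.

Definition linear_pair : {linear A -> (B * C)%type} := linear_pair_fun.
End LinearPair.

Lemma projective_prod P Q :
  projective P -> projective Q -> projective (P * Q)%type.
Proof.
move=> projP projQ M N p f p_surj.
have [g gE] := projP M N p (f \o linear_pair idfun \0) p_surj.
have [h hE] := projQ M N p (f \o linear_pair \0 idfun) p_surj.
exists ((g \o fst) \+ (h \o snd)) => -[x y] /=.
rewrite linearD gE hE /= -linearD; congr (f _).
by congr (_, _); rewrite /= ?addr0 ?add0r.
Qed.

Lemma factors_comp A B C D (h : {linear C -> D}) (f : {linear B -> C})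
    (g : {linear A -> B}) :
  factors_through_projective f -> factors_through_projective (h \o f \o g).
Proof.
case=> P projP [u [v fE]]; exists P => //; exists (u \o g), (h \o v) => a /=.
by rewrite fE.
Qed.

Definition proj_pred A B : {pred {linear A -> B}} :=
  fun f => `[< factors_through_projective f >].

Lemma proj_pred_closed A B : zmod_closed (@proj_pred A B).
Proof.
split=> [|f g].
  apply/asboolP; exists (Ker (idfun : {linear A -> A})).
    exact: projective_ker_id.
  by exists \0, \0 => a.
move=> /asboolP[P projP [u [v fE]]] /asboolP[Q projQ [u' [v' gE]]].
apply/asboolP; exists (P * Q)%type; first exact: projective_prod.
exists (linear_pair u u').
by exists ((v \o fst) \- (v' \o snd)) => a /=; rewrite -fE -gE.
Qed.
HB.instance Definition _ A B :=
  GRing.isZmodClosed.Build {linear A -> B} (@proj_pred A B)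
    (@proj_pred_closed A B).

Definition stable_hom A B : zmodType := {quot (@proj_pred A B)}.

Definition stable_class A B (f : {linear A -> B}) : stable_hom A B :=
  \pi_({quot (@proj_pred A B)}) f.

Definition stable_repr A B (u : stable_hom A B) : {linear A -> B} := repr u.

Lemma stable_reprK A B : cancel (@stable_repr A B) (@stable_class A B).
Proof. exact: reprK. Qed.

Lemma stable_class_eq A B (f g : {linear A -> B}) :
  stable_class f = stable_class g <-> factors_through_projective (f - g).
Proof.
split=> [/eqP|fg]; first by rewrite -[_ == _]idealrBE => /asboolP.
by apply/eqP; rewrite -[_ == _]idealrBE; apply/asboolP.
Qed.

Lemma stable_classB A B :
  {morph @stable_class A B : f g / f - g >-> f - g}.
Proof. exact: (raddfB (\pi_({quot (@proj_pred A B)}))). Qed.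

Definition stable_comp A B C (v : stable_hom B C) (u : stable_hom A B) :
    stable_hom A C :=
  stable_class (stable_repr v \o stable_repr u).

Lemma stable_compE A B C (g : {linear B -> C}) (f : {linear A -> B}) :
  stable_comp (stable_class g) (stable_class f) = stable_class (g \o f).
Proof.
set g' := stable_repr (stable_class g); set f' := stable_repr (stable_class f).
have gE : factors_through_projective (g' - g).
  by apply/stable_class_eq; rewrite stable_reprK.
have fE : factors_through_projective (f' - f).
  by apply/stable_class_eq; rewrite stable_reprK.
transitivity (stable_class (g \o f')); apply/stable_class_eq.
  have := factors_comp idfun f' gE; congr factors_through_projective.
  exact: linear_eq.
have := factors_comp g idfun fE; congr factors_through_projective.
by apply: linear_eq => a /=; rewrite linearB.
Qed.

Lemma stable_comp1m A B (u : stable_hom A B) :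
  stable_comp (stable_class idfun) u = u.
Proof.
rewrite -[u]stable_reprK stable_compE; congr stable_class; exact: linear_eq.
Qed.

Lemma stable_compm1 A B (u : stable_hom A B) :
  stable_comp u (stable_class idfun) = u.
Proof.
rewrite -[u]stable_reprK stable_compE; congr stable_class; exact: linear_eq.
Qed.

Lemma stable_compmA A B C D (w : stable_hom C D) (v : stable_hom B C)
    (u : stable_hom A B) :
  stable_comp w (stable_comp v u) = stable_comp (stable_comp w v) u.
Proof.
rewrite -[w]stable_reprK -[v]stable_reprK -[u]stable_reprK !stable_compE.
congr stable_class; exact: linear_eq.
Qed.

Definition StMod : category :=
  @Category (lmodType R) (fun A B => stable_hom A B)
    (fun A => stable_class (idfun : {linear A -> A})) stable_comp
    stable_comp1m stable_compm1 stable_compmA.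

Definition stableQ : functor (Mod R) StMod :=
  @Functor (Mod R) StMod (fun A => A) stable_class (fun A => erefl)
    (fun A B C g f => esym (stable_compE g f)).

Lemma stable_comp_additive X A B (v : stable_hom A B) :
  zmod_morphism (stable_comp v : stable_hom X A -> stable_hom X B).
Proof.
move=> u u'; rewrite -[v]stable_reprK -[u]stable_reprK -[u']stable_reprK.
rewrite -stable_classB !stable_compE -stable_classB; congr stable_class.
by apply: linear_eq => a /=; rewrite linearB.
Qed.
HB.instance Definition _ X A B (v : stable_hom A B) :=
  GRing.isZmodMorphism.Build (stable_hom X A) (stable_hom X B)
    (@stable_comp X A B v) (@stable_comp_additive X A B v).

Definition stable_postcomp X A B (v : stable_hom A B) :
    {additive stable_hom X A -> stable_hom X B} := stable_comp v.

Lemma stable_postcomp1 X A :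
  stable_postcomp X (stable_class (idfun : {linear A -> A})) = idfun.
Proof. by apply: additive_eq => u; exact: stable_comp1m. Qed.

Lemma stable_postcompM X A B C (w : stable_hom B C) (v : stable_hom A B) :
  stable_postcomp X (stable_comp w v) =
  stable_postcomp X w \o stable_postcomp X v.
Proof. by apply: additive_eq => u /=; rewrite stable_compmA. Qed.

Definition stable_hom_functor X : functor StMod Ab :=
  @Functor StMod Ab (stable_hom X) (@stable_postcomp X)
    (@stable_postcomp1 X) (@stable_postcompM X).

(* Hom(X, Q(-)) in the stable category, as a functor to abelian groups *)
Definition stable_h X : functor (Mod R) Ab :=
  fcomp (stable_hom_functor X) stableQ.

(* F sends every exact 0 -> A -> B -> C to an exact 0 -> F A -> F B -> F C. *)
Definition left_exact (F : functor (Mod R) Ab) : Prop :=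
  forall A B C (f : {linear A -> B}) (g : {linear B -> C}),
    injective f -> (forall b, g b = 0 <-> exists a, f a = b) ->
    injective (fmap F f : {additive F A -> F B}) /\
    (forall y, (fmap F g : {additive F B -> F C}) y = 0 <->
       exists x, (fmap F f : {additive F A -> F B}) x = y).
End Stable.

(* Main.v *)
(* All eight conditions are compared with the property that every submodule of
   a projective module is projective.  Left heredity implies it by a Kaplansky
   argument: coordinates on a free module map S to R, the lifting problem for S
   is solved by Zorn's lemma on the sets Y of coordinates for which it is solved
   on the elements supported in Y, and one more coordinate can always be added
   because its values form a left ideal, hence a projective module.

   Given the property, if g y factors through a projective module via u, then
   Im u is projective and lifts along g, so y is, up to a map factoring through
   a projective module, killed by g; kernels, and with them all finite limits,
   are therefore computed in the stable category as in Mod.  Conversely, if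
   injections become monomorphisms in the stable category, then an injection
   of S into a projective module, which is stably zero, forces S to be stably
   zero, i.e. projective. *)
Require Import Defs.
From HB Require Import structures.
From mathcomp Require Import all_boot ssralg.
From mathcomp Require Import boolp classical_sets fsbigop.

Set Implicit Arguments.
Unset Strict Implicit.
Unset Printing Implicit Defensive.

Import GRing.Theory.
Local Open Scope ring_scope.

(** * Products of modules and linear maps *)

Section DependentProduct.
Variables (R : pzRingType) (I : Type) (M : I -> lmodType R).

Definition dprod : Type := forall i, M i.

HB.instance Definition _ := gen_eqMixin dprod.
HB.instance Definition _ := gen_choiceMixin dprod.

Implicit Types f g h : dprod.
Definition dprod_zero : dprod := fun=> 0.
Definition dprod_opp f : dprod := fun i => - f i.
Definition dprod_add f g : dprod := fun i => f i + g i.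
Definition dprod_scale (a : R) f : dprod := fun i => a *: f i.

Lemma dprod_ext f g : (forall i, f i = g i) -> f = g.
Proof. exact: functional_extensionality_dep. Qed.

Lemma dprod_addA : associative dprod_add.
Proof. by move=> f g h; apply: dprod_ext => i; apply: addrA. Qed.
Lemma dprod_addC : commutative dprod_add.
Proof. by move=> f g; apply: dprod_ext => i; apply: addrC. Qed.
Lemma dprod_add0 : left_id dprod_zero dprod_add.
Proof. by move=> f; apply: dprod_ext => i; apply: add0r. Qed.
Lemma dprod_addN : left_inverse dprod_zero dprod_opp dprod_add.
Proof. by move=> f; apply: dprod_ext => i; apply: addNr. Qed.

HB.instance Definition _ := GRing.isZmodule.Build dprod
  dprod_addA dprod_addC dprod_add0 dprod_addN.

Lemma dprod_scaleA a b f :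
  dprod_scale a (dprod_scale b f) = dprod_scale (a * b) f.
Proof. by apply: dprod_ext => i; apply: scalerA. Qed.
Lemma dprod_scale1 : left_id 1 dprod_scale.
Proof. by move=> f; apply: dprod_ext => i; apply: scale1r. Qed.
Lemma dprod_scaleDr : right_distributive dprod_scale +%R.
Proof. by move=> a f g; apply: dprod_ext => i; apply: scalerDr. Qed.
Lemma dprod_scaleDl f : {morph dprod_scale^~ f : a b / a + b}.
Proof. by move=> a b; apply: dprod_ext => i; apply: scalerDl. Qed.

HB.instance Definition _ := GRing.Zmodule_isLmodule.Build R dprod
  dprod_scaleA dprod_scale1 dprod_scaleDr dprod_scaleDl.
End DependentProduct.

Section LinearMaps.
Variable R : pzRingType.
Implicit Types A B C K P X : lmodType R.

Lemma linear_pack A B (f : A -> B) : linear f ->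
  exists g : {linear A -> B}, forall a, g a = f a.
Proof.
move=> f_lin; pose L := GRing.isLinear.Build R A B *:%R f f_lin.
pose F : {linear A -> B} := HB.pack f L.
by exists F.
Qed.

Lemma dprod_pair X I (M : I -> lmodType R) (f : forall i, {linear X -> M i}) :
  exists g : {linear X -> dprod M}, forall x i, g x i = f i x.
Proof.
have [|g gE] := @linear_pack X (dprod M) (fun x i => f i x).
  by move=> a x y; apply: dprod_ext => i; rewrite linearP.
by exists g => x i; rewrite gE.
Qed.

Lemma dprod_proj I (M : I -> lmodType R) (i : I) :
  exists g : {linear dprod M -> M i}, forall f, g f = f i.
Proof. exact: (linear_pack (f := fun f : dprod M => f i)). Qed.

Lemma dprod_inj (I : eqType) (M : I -> lmodType R) (i : I) :
  exists g : {linear M i -> dprod M},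
    forall x j, g x j = @dfwith I M (fun=> 0) i x j.
Proof.
pose f x : dprod M := @dfwith I M (fun=> 0) i x.
have [|g gE] := @linear_pack (M i) (dprod M) f.
  move=> a x y; apply: dprod_ext => j; rewrite -[RHS]/(a *: f x j + f y j) /f.
  have [ij|ij] := eqVneq i j; first by case: j / ij; rewrite !dfwith_in.
  by rewrite !dfwith_out //= scaler0 addr0.
by exists g => x j; rewrite gE.
Qed.

Lemma linear_inj A B (f : {linear A -> B}) :
  (forall a, f a = 0 -> a = 0) -> injective f.
Proof. by move=> f0 a b fab; apply/subr0_eq/f0; rewrite linearB fab subrr. Qed.

Lemma ker_inj A B (f : {linear A -> B}) : injective (ker f).
Proof. exact: val_inj. Qed.

Lemma ker0 A B (f : {linear A -> B}) (k : Ker f) : f (ker f k) = 0.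
Proof. by case: k => k /= /eqP. Qed.

Lemma kerE A B (f : {linear A -> B}) a : f a = 0 -> exists k, ker f k = a.
Proof. by move/eqP => fa; exists (exist _ a fa). Qed.

(** Injectivity makes the chosen preimages unique, hence linear in the argument. *)
Lemma linear_lift_inj K A X (k : {linear K -> A}) (x : {linear X -> A}) :
  injective k -> (forall a, exists b, k b = x a) ->
  exists u : {linear X -> K}, forall a, k (u a) = x a.
Proof.
move=> k_inj /choice[u uE]; have [|v vE] := @linear_pack X K u.
  by move=> r a b; apply: k_inj; rewrite linearP !uE linearP.
by exists v => a; rewrite vE.
Qed.

(** The definition of [projective] lifts along surjections; in [stable_lift] below, only the values
    of [h] are known to be hit. *)
Lemma projective_lift P B C (g : {linear B -> C}) (h : {linear P -> C}) :
  projective P -> (forall p, exists b, g b = h p) ->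
  exists q : {linear P -> B}, forall p, g (q p) = h p.
Proof.
move=> projP gh.
(* The pullback of g along h surjects onto P, so that projection splits. *)
pose d : {linear (B * P)%type -> C} := (g \o fst) \- (h \o snd).
have [|s sE] := projP _ _ (snd \o ker d : {linear Ker d -> P}) idfun.
  move=> p; have [b gb] := gh p.
  have [|k kE] := @kerE _ _ d (b, p); first by rewrite /= gb subrr.
  by exists k; rewrite -[LHS]/(ker d k).2 kE.
exists (fst \o ker d \o s) => p /=.
(* Elements of [Ker d] are the pairs on which [g] and [h] agree. *)
have /subr0_eq /= -> := ker0 (s p).
by rewrite [snd _]sE.
Qed.

Lemma projective_retract A P (i : {linear A -> P}) (r : {linear P -> A}) :
  (forall a, r (i a) = a) -> projective P -> projective A.
Proof.
move=> riK projP M N p f p_surj; have [g gE] := projP _ _ p (f \o r) p_surj.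
by exists (g \o i) => a; rewrite /= gE /= riK.
Qed.

End LinearMaps.

(** * Submodules of projective modules over a hereditary ring *)

Section Coordinates.
Variables (R : pzRingType) (X : eqType).

(** Such a family amounts to an embedding of [S] into the free module on [X]. *)
Definition coordinates (S : lmodType R) (c : X -> {linear S -> R^o}) : Prop :=
  (forall a, exists s : seq X, forall x, c x a != 0 -> x \in s) /\
  (forall a, (forall x, c x a = 0) -> a = 0).

Variables (S : lmodType R) (c : X -> {linear S -> R^o}).

Definition supp_pred (Y : set X) : {pred S} :=
  fun a => `[< forall x, c x a != 0 -> Y x >].

Lemma supp_predP (Y : set X) a :
  (a \in supp_pred Y) <-> (forall x, c x a != 0 -> Y x).
Proof. by split=> [/asboolP|?]; last apply/asboolP. Qed.

Lemma supp_pred_closed Y : submod_closed (supp_pred Y).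
Proof.
split=> [|r a b]; first by apply/supp_predP => x; rewrite linear0 eqxx.
move=> /supp_predP aY /supp_predP bY; apply/supp_predP => x.
have [cxa|/aY //] := eqVneq (c x a) 0; have [cxb|/bY //] := eqVneq (c x b) 0.
by rewrite linearP cxa cxb scaler0 addr0 eqxx.
Qed.
HB.instance Definition _ Y :=
  GRing.isSubmodClosed.Build R S (supp_pred Y) (supp_pred_closed Y).

Lemma supp_predS (Y Z : set X) a :
  (forall x, Y x -> Z x) -> a \in supp_pred Y -> a \in supp_pred Z.
Proof. by move=> YZ /supp_predP aY; apply/supp_predP => x /aY/YZ. Qed.

Variables (M N : lmodType R) (p : {linear M -> N}) (f : {linear S -> N}).

(* The values of plift_fun outside supp_pred plift_dom are irrelevant, so
   plift_le is only a preorder. *)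
Record partial_lift := PartialLift {
  plift_dom : set X;
  plift_fun :> S -> M;
  plift_linear : forall r a b,
    a \in supp_pred plift_dom -> b \in supp_pred plift_dom ->
    plift_fun (r *: a + b) = r *: plift_fun a + plift_fun b;
  pliftE : forall a, a \in supp_pred plift_dom -> p (plift_fun a) = f a
}.

Definition plift_le : rel partial_lift := fun g h =>
  `[< (forall x, plift_dom g x -> plift_dom h x) /\
      forall a, a \in supp_pred (plift_dom g) -> h a = g a >].

Lemma plift_le_refl g : plift_le g g.
Proof. exact/asboolP. Qed.

Lemma plift_le_trans g h k : plift_le g h -> plift_le h k -> plift_le g k.
Proof.
move=> /asboolP[gh gE] /asboolP[hk hE]; apply/asboolP.
split=> [x /gh/hk //|a ag].
by rewrite hE ?gE //; apply: supp_predS ag.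
Qed.

Hypothesis cP : coordinates c.

(** Joint injectivity of the coordinates leaves only 0 supported in the empty set. *)
Definition plift_empty : partial_lift.
Proof.
have supp0 a : a \in supp_pred set0 -> a = 0.
  move=> /supp_predP a0; apply: cP.2 => x.
  by apply/eqP; have [//|/a0] := eqVneq (c x a) 0.
apply: (@PartialLift set0 (fun=> 0)) => [r a b _ _|a /supp0 ->].
  by rewrite scaler0 addr0.
by rewrite !linear0.
Qed.

(** Supports are finite, so an element supported in the union of the domains is already supported in
    the domain of one member of the chain, whose value the bound takes. *)
Lemma plift_chain (A : set partial_lift) : total_on A plift_le ->
  exists h, forall g, A g -> plift_le g h.
Proof.
(* The empty chain is bounded by [plift_empty]; otherwise [g0] serves the empty list in [cover]. *)
move=> A_total; have [[g0 Ag0]|A0] := pselect (exists g, A g); last first.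
  by exists plift_empty => g Ag; case: A0; exists g.
pose Y : set X := fun x => exists2 g, A g & plift_dom g x.
have cover (s : seq X) : (forall x, x \in s -> Y x) ->
    exists2 g, A g & forall x, x \in s -> plift_dom g x.
  elim: s => [|x s IHs] sY; first by exists g0.
  have [|g Ag gs] := IHs; first by move=> y ys; apply: sY; rewrite inE ys orbT.
  have [|h Ah hx] := sY x; first exact: mem_head.
  case: (A_total _ _ Ag Ah) => /asboolP[gh _]; [exists h|exists g] => // y.
    by rewrite inE => /predU1P[-> //|/gs/gh].
  by rewrite inE => /predU1P[->|/gs //]; apply: gh.
have cover1 a : a \in supp_pred Y ->
    exists2 g, A g & a \in supp_pred (plift_dom g).
  move=> /supp_predP aY; have [s cs] := cP.1 a.
  (* The list [s] may contain points outside [Y] where the coordinate of [a] vanishes; these are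
     filtered out. *)
  have [|g Ag gs] := cover [seq x <- s | c x a != 0].
    by move=> x; rewrite mem_filter => /andP[/aY].
  exists g => //; apply/supp_predP => x cxa.
  by apply: gs; rewrite mem_filter cxa cs.
have agree g h a : A g -> A h -> a \in supp_pred (plift_dom g) ->
    a \in supp_pred (plift_dom h) -> g a = h a.
  by move=> Ag Ah ga ha; case: (A_total _ _ Ag Ah) => /asboolP[_ ->].
have [F FE] : exists F : S -> M, forall g a, A g ->
    a \in supp_pred (plift_dom g) -> F a = g a.
  have /choice[F FE] (a : S) : exists m, forall g, A g ->
      a \in supp_pred (plift_dom g) -> m = g a.
    have [[g Ag ag]|no] :=
      pselect (exists2 g, A g & a \in supp_pred (plift_dom g)).
      by exists (g a) => h Ah ah; apply: agree.
    (* No member of the chain constrains the value at [a], so 0 is an arbitrary default. *)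
    by exists 0 => g Ag ag; case: no; exists g.
  by exists F => g a Ag; apply: FE.
have cover2 a b : a \in supp_pred Y -> b \in supp_pred Y ->
    exists g, [/\ A g, a \in supp_pred (plift_dom g)
                & b \in supp_pred (plift_dom g)].
  move=> /cover1[g Ag ag] /cover1[h Ah bh].
  case: (A_total _ _ Ag Ah) => /asboolP[gh _]; [exists h|exists g]; split=> //.
    exact: supp_predS ag.
  exact: supp_predS bh.
have F_lin r a b : a \in supp_pred Y -> b \in supp_pred Y ->
    F (r *: a + b) = r *: F a + F b.
  move=> aY bY; have [g [Ag ag bg]] := cover2 _ _ aY bY.
  rewrite (FE g) ?(FE g a) ?(FE g b) //; first exact: plift_linear.
  by rewrite rpredD ?rpredZ.
have F_lift a : a \in supp_pred Y -> p (F a) = f a.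
  by move=> /cover1[g Ag ag]; rewrite (FE g) // pliftE.
exists (PartialLift F_lin F_lift) => g Ag.
apply/asboolP; split=> [x gx|a ag] /=.
  by exists g.
exact: FE.
Qed.

Hypotheses (hered : left_hereditary R) (p_surj : forall n, exists m, p m = n).

(** The values of [c x] on [T] form a left ideal, projective by heredity, so [ct] splits onto its
    image. Each [t] is the sum of [rest t], where [g] applies, and [sg (cor t)], whose image under
    [f] is lifted by [l] on the ideal. *)
Lemma plift_extend (g : partial_lift) (x : X) :
  exists2 h, plift_le g h & plift_dom h x.
Proof.
have [gx|gx] := pselect (plift_dom g x).
  by exists g; rewrite ?plift_le_refl.
pose Y : set X := fun y => plift_dom g y \/ y = x.
pose T : lmodType R := submodule (supp_pred Y).
pose ct : {linear T -> R^o} := c x \o (\val : {linear T -> S}).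
have projI : projective (Im ct) by apply: hered.
have [|sg sgE] := projI _ _ (corestriction ct) idfun.
  move=> [r rI]; have /asboolP[t tE] := rI; exists t; exact: val_inj.
have [l lE] := projI _ _ p (f \o (\val : {linear T -> S}) \o sg) p_surj.
pose cor := corestriction ct.
pose rest (t : T) : S := val t - val (sg (cor t)).
(* Subtracting [sg (cor t)] kills the coordinate [x], the only one in [Y] outside the domain of
   [g]. *)
have rest_supp t : rest t \in supp_pred (plift_dom g).
  apply/supp_predP => y; have [->|yx] := eqVneq y x.
    rewrite /rest linearB -[c x (\val (sg _))]/(val (cor (sg (cor t)))) sgE.
    by rewrite subrr eqxx.
  have /supp_predP tY := valP (t - sg (cor t)) => /tY[//|yx'].
  by rewrite yx' eqxx in yx.
have rest_lin r a b : rest (r *: a + b) = r *: rest a + rest b.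
  by rewrite /rest !linearP /= scalerBr scalerN addrACA.
pose h t := g (rest t) + l (cor t).
have h_lin r a b : h (r *: a + b) = r *: h a + h b.
  rewrite /h rest_lin plift_linear // [cor _]linearP [l (_ + _)]linearP.
  by rewrite scalerDr addrACA.
have h_lift t : p (h t) = f (val t).
  rewrite /h linearD pliftE // lE /= -linearD; congr (f _).
  by rewrite /rest subrK.
(* A partial lift is a total function, so [h] is extended by 0 off [supp_pred Y]. *)
pose F a := if insub a is Some t then h (t : T) else 0.
have FE a (aY : a \in supp_pred Y) : F a = h (Sub a aY) by rewrite /F insubT.
have F_lin r a b : a \in supp_pred Y -> b \in supp_pred Y ->
    F (r *: a + b) = r *: F a + F b.
  move=> aY bY; have abY : r *: a + b \in supp_pred Y by rewrite rpredD ?rpredZ.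
  by rewrite !FE -h_lin; congr (h _); apply: val_inj.
have F_lift a : a \in supp_pred Y -> p (F a) = f a.
  by move=> aY; rewrite FE h_lift.
exists (PartialLift F_lin F_lift); last by right.
apply/asboolP; split=> [y|a ag] /=; first by left.
have aY : a \in supp_pred Y by apply: supp_predS ag => y; left.
(* As [x] is not in the domain of [g], it is not in the support of [a]; hence the new lift agrees
   with [g] at [a]. *)
have cor0 : cor (Sub a aY) = 0.
  apply: val_inj; apply/eqP; apply: contra_notT gx.
  by move: ag => /supp_predP; apply.
by rewrite FE /h /rest cor0 !linear0 !addr0.
Qed.

(** By [plift_extend] the domain of a maximal partial lift contains every coordinate, so that lift
    is defined on all of [S]. *)
Lemma lift_exists : exists g : {linear S -> M}, forall a, p (g a) = f a.
Proof.
have [g g_max] := ZL_preorder plift_empty plift_le_refl plift_le_trans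
  plift_chain.
have gT a : a \in supp_pred (plift_dom g).
  apply/supp_predP => x _; have [h gh hx] := plift_extend g x.
  by have /asboolP[/(_ x hx)] := g_max h gh.
have [|G GE] := @linear_pack _ _ _ g.
  by move=> r a b; rewrite plift_linear.
by exists G => a; rewrite GE pliftE.
Qed.

End Coordinates.

Lemma projective_coordinates (R : pzRingType) (X : eqType) (S : lmodType R)
    (c : X -> {linear S -> R^o}) :
  left_hereditary R -> coordinates c -> projective S.
Proof. by move=> hered cP M N p f p_surj; apply: (lift_exists f cP hered). Qed.

(** * Free modules and coordinates on projective modules *)

Section FreeModule.
Variables (R : pzRingType) (X : choiceType).

Definition finsupp_pred : {pred dprod (fun _ : X => R^o : lmodType R)} :=
  fun a => `[< exists s : seq X, forall x, a x != 0 -> x \in s >].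

Lemma finsupp_pred_closed : submod_closed finsupp_pred.
Proof.
split=> [|r a b]; first by apply/asboolP; exists [::] => x; rewrite eqxx.
move=> /asboolP[s as_] /asboolP[t bt]; apply/asboolP; exists (s ++ t) => x.
rewrite mem_cat -[_ x]/(r *: a x + b x).
have [ax|/as_ -> //] := eqVneq (a x) 0; have [bx|/bt ->] := eqVneq (b x) 0.
  by rewrite ax bx scaler0 addr0 eqxx.
by rewrite orbT.
Qed.
HB.instance Definition _ := GRing.isSubmodClosed.Build R
  (dprod (fun _ : X => R^o : lmodType R)) finsupp_pred finsupp_pred_closed.

Definition free_module : lmodType R := submodule finsupp_pred.

Lemma free_support (a : free_module) :
  exists s : seq X, forall x, val a x != 0 -> x \in s.
Proof. by have /asboolP := valP a. Qed.

Lemma free_coordinates : exists c : X -> {linear free_module -> R^o},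
  coordinates c.
Proof.
have /choice[pr prE] := @dprod_proj R X (fun=> R^o).
exists (fun x => pr x \o \val); split=> a.
  by have [s sP] := free_support a; exists s => x; rewrite /= prE; apply: sP.
move=> a0; apply: val_inj; apply: dprod_ext => x.
by have := a0 x; rewrite /= prE.
Qed.

(** The index set may be infinite; only the finitely many nonzero coefficients contribute. *)
Definition free_eval_fun (M : lmodType R) (e : X -> M) (a : free_module) : M :=
  \sum_(x \in [set: X]) (val a x : R) *: e x.

Lemma free_eval_funE (M : lmodType R) (e : X -> M) (a : free_module)
    (s : seq X) :
  uniq s -> (forall x, val a x != 0 -> x \in s) ->
  free_eval_fun e a = \sum_(x <- s) (val a x : R) *: e x.
Proof.
move=> s_uniq sP; rewrite /free_eval_fun (fsbigE s) //; last first.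
  move=> x _ xs; have -> : val a x = 0; last by rewrite scale0r.
  by apply/eqP; apply: contraNT xs => /sP.
by apply: eq_bigl => x; rewrite in_setT.
Qed.

(** Allowing any duplicate-free list that covers the support lets [a], [b] and [r *: a + b] be
    summed over one list. *)
Lemma free_eval (M : lmodType R) (e : X -> M) :
  exists g : {linear free_module -> M},
    forall a (s : seq X), uniq s -> (forall x, val a x != 0 -> x \in s) ->
      g a = \sum_(x <- s) (val a x : R) *: e x.
Proof.
have [|g gE] := @linear_pack _ _ _ (free_eval_fun e); last first.
  by exists g => a s *; rewrite gE; apply: free_eval_funE.
move=> r a b; have [s sa] := free_support a; have [t tb] := free_support b.
pose st := undup (s ++ t).
have st_a x : val a x != 0 -> x \in st.
  by move/sa; rewrite mem_undup mem_cat => ->.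
have st_b x : val b x != 0 -> x \in st.
  by move/tb; rewrite mem_undup mem_cat orbC => ->.
rewrite !(@free_eval_funE _ _ _ st) ?undup_uniq //.
  rewrite scaler_sumr -big_split; apply: eq_bigr => x _ /=.
  by rewrite scalerA -scalerDl.
move=> x; rewrite -[_ x]/(r * val a x + val b x).
have [ax|/st_a //] := eqVneq (val a x) 0.
by rewrite ax mulr0 add0r => /st_b.
Qed.

End FreeModule.

(** The dual basis argument: a section [s] of the evaluation map embeds [P] in the free module on
    its underlying set, and coordinates restrict along [s]. *)
Lemma projective_has_coordinates (R : pzRingType) (P : lmodType R) :
  projective P -> exists c : P -> {linear P -> R^o}, coordinates c.
Proof.
move=> projP; have [g gE] := free_eval (@id P).
have [|s sE] := projP _ _ g idfun.
  (* [d] is the basis vector at [x], which evaluates to [x]. *)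
  move=> x; pose d : dprod (fun _ : P => R^o : lmodType R) :=
    fun y => if y == x then 1 else 0.
  have dfin : d \in @finsupp_pred R P.
    by apply/asboolP; exists [:: x] => y; rewrite /d inE;
      case: (y =P x) => // _; rewrite eqxx.
  pose a : free_module R P := Sub d dfin.
  exists a; rewrite (gE a [:: x]) //.
    by rewrite big_seq1 -[val a x]/(d x) /d eqxx scale1r.
  by move=> y; rewrite -[val a y]/(d y) /d inE;
    case: (y =P x) => // _; rewrite eqxx.
have [c [c_fin c_inj]] := free_coordinates R P.
exists (fun x => c x \o s); split=> [a|a a0]; first exact: c_fin.
have sa : s a = 0 by exact: c_inj.
by rewrite -[a]sE sa linear0.
Qed.

Lemma hereditary_projective_sub (R : pzRingType) (S P : lmodType R)
    (j : {linear S -> P}) :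
  left_hereditary R -> projective P -> injective j -> projective S.
Proof.
move=> hered projP j_inj.
have [c [c_fin c_inj]] := projective_has_coordinates projP.
apply: (@projective_coordinates _ _ _ (fun x => c x \o j)) => //.
split=> [a|a a0]; first exact: c_fin.
by apply: j_inj; rewrite linear0; apply: c_inj.
Qed.

(** * The stable category *)

(** Submodules are given as injections, which covers kernels, images and left ideals alike. *)
Definition subprojective_hereditary (R : pzRingType) : Prop :=
  forall (S P : lmodType R) (j : {linear S -> P}),
    projective P -> injective j -> projective S.

Section StableHom.
Variable R : pzRingType.
Implicit Types A B C K P X : lmodType R.

Lemma factors_ext A B (f g : {linear A -> B}) :
  (forall a, f a = g a) ->
  factors_through_projective f -> factors_through_projective g.
Proof.
by move=> fg [P projP [u [v fE]]]; exists P => //; exists u, v => a;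
  rewrite -fg.
Qed.

Lemma factors_compl A B C (h : {linear B -> C}) (f : {linear A -> B}) :
  factors_through_projective f -> factors_through_projective (h \o f).
Proof. by move=> /(factors_comp h idfun); apply: factors_ext. Qed.

Lemma factors_compr A B C (h : {linear B -> C}) (f : {linear A -> B}) :
  factors_through_projective h -> factors_through_projective (h \o f).
Proof. by move=> /(factors_comp idfun f); apply: factors_ext. Qed.

Lemma factorsB A B (f g : {linear A -> B}) :
  factors_through_projective f -> factors_through_projective g ->
  factors_through_projective (f \- g).
Proof.
move=> /asboolP ff /asboolP fg.
have /asboolP : f - g \in @proj_pred R A B by apply: rpredB.
exact: factors_ext.
Qed.

Lemma factors0 A B (f : {linear A -> B}) :
  (forall a, f a = 0) -> factors_through_projective f.
Proof.
move=> f0; have /asboolP : 0 \in @proj_pred R A B by apply: rpred0.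
by apply: factors_ext => a; rewrite f0.
Qed.

Lemma factors_projectiver A P (f : {linear A -> P}) :
  projective P -> factors_through_projective f.
Proof. by move=> projP; exists P => //; exists f, idfun. Qed.

Lemma factors_projectivel B P (f : {linear P -> B}) :
  projective P -> factors_through_projective f.
Proof. by move=> projP; exists P => //; exists idfun, f. Qed.

(** A factorization of the identity exhibits [A] as a retract of a projective module. *)
Lemma factors_idP A :
  factors_through_projective (idfun : {linear A -> A}) <-> projective A.
Proof.
split=> [[P projP [u [v uvE]]]|]; last exact: factors_projectivel.
by apply: (projective_retract (i := u) (r := v)) => // a; rewrite -uvE.
Qed.

Lemma projective_ker_inj A B (f : {linear A -> B}) :
  injective f -> projective (Ker f).
Proof.
move=> f_inj; apply/factors_idP/factors0 => a; apply: ker_inj; apply: f_inj.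
by rewrite ker0 !linear0.
Qed.

Lemma stable_classP A B (f g : {linear A -> B}) :
  stable_class f = stable_class g <-> factors_through_projective (f \- g).
Proof.
by split=> [/stable_class_eq|fg]; [|apply/stable_class_eq; move: fg];
  apply: factors_ext.
Qed.

(** Stable composition is additive, so monicity can be tested against the zero map. *)
Lemma stable_monicP A B (f : {linear A -> B}) :
  monic (fmap (stableQ R) f) <->
  forall X (x : {linear X -> A}),
    factors_through_projective (f \o x) -> factors_through_projective x.
Proof.
split=> [f_monic X x fx|f_monic X u v].
  suff /stable_classP : stable_class x = stable_class (\0 : {linear X -> A}).
    by apply: factors_ext => a /=; rewrite subr0.
  apply: (f_monic X : forall u v : stable_hom X A, _); rewrite /= !stable_compE.
  apply/stable_classP; apply: factors_ext fx => a /=.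
  by rewrite linear0 subr0.
rewrite -[u]stable_reprK -[v]stable_reprK /= !stable_compE.
move=> /stable_classP fuv.
apply/stable_classP; apply: f_monic; apply: factors_ext fuv => a /=.
by rewrite linearB.
Qed.

(** The test pair consists of [ker f] and the zero map, which [f] equalizes. *)
Lemma monic_injective A B (f : {linear A -> B}) :
  monic (f : hom (Mod R) A B) <-> injective f.
Proof.
split=> [f_monic|f_inj X u v fuv].
  apply: linear_inj => a /kerE[k <-].
  have -> : ker f = (\0 : {linear Ker f -> A}); last by [].
  by apply: (f_monic (Ker f)); apply: linear_eq => b /=;
    rewrite [LHS]ker0 linear0.
apply: linear_eq => a; apply: f_inj.
exact: (congr1 (fun h : {linear X -> B} => h a) fuv).
Qed.

(** For finite [I], [f] is the sum of the maps [inj i \o p i], and maps factoring through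
    projectives form a group. *)
Lemma dprod_factors X (I : finType) (M : I -> lmodType R)
    (f : {linear X -> dprod M}) (p : forall i, {linear X -> M i}) :
  (forall x i, f x i = p i x) -> (forall i, factors_through_projective (p i)) ->
  factors_through_projective f.
Proof.
move=> fE fp; have /fin_all_exists[inj injE] := @dprod_inj R I M.
have /asboolP : \sum_i (inj i \o p i : {linear X -> dprod M})
    \in @proj_pred R X (dprod M).
  by apply: rpred_sum => i _; apply/asboolP/factors_compl.
apply: factors_ext => x; apply: dprod_ext => i; rewrite fE.
transitivity (\sum_j inj j (p j x) i).
  by elim/big_rec2: _ => // j y g _ <-.
rewrite (bigD1 i) //= injE dfwith_in big1 ?addr0 // => j ji.
by rewrite injE dfwith_out.
Qed.

(** * Zero morphisms of the module and stable categories *)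

Section ZeroMorphism.
Variables (A B : lmodType R) (f : {linear A -> B}).

Lemma zero_morphism_Mod :
  zero_morphism (f : hom (Mod R) A B) <-> forall a, f a = 0.
Proof.
split=> [[Z Z0 [u [v ->]]] a|f0].
  have [_ [z [_ z_uniq]]] := Z0 Z.
  have : idfun = \0 :> {linear Z -> Z} by rewrite -(z_uniq idfun) ?(z_uniq \0).
  move/(congr1 (fun h : {linear _ -> _} => h (u a))) => /= u0.
  by rewrite [u a]u0 linear0.
pose Z : lmodType R := Ker (idfun : {linear A -> A}).
have Z0 (z : Z) : z = 0 by apply: ker_inj; rewrite linear0; apply: (ker0 z).
exists Z; last first.
  by exists (linear_zero A Z), (linear_zero Z B); apply: linear_eq => a;
    rewrite f0.
move=> X; split; [exists (linear_zero Z X)|exists (linear_zero X Z)];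
  split=> // h _; apply: linear_eq => x /=.
  by rewrite (Z0 x) linear0.
by rewrite [RHS]Z0.
Qed.

Lemma zero_object_projective P : projective P -> zero_object (P : StMod R).
Proof.
move=> projP X; split; [exists (stable_class (linear_zero P X))
  |exists (stable_class (linear_zero X P))]; split=> // h _.
  rewrite -[h]stable_reprK; apply/stable_classP.
  exact: factors_projectivel.
rewrite -[h]stable_reprK; apply/stable_classP.
exact: factors_projectiver.
Qed.

(** Projective modules are stable zero objects; conversely, the only stable map from a zero object
    to [B] is the class of 0. *)
Lemma zero_morphism_StMod :
  zero_morphism (stable_class f : hom (StMod R) A B) <->
  factors_through_projective f.
Proof.
split=> [[Z Z0 [u [v]]]|[P projP [u [v fE]]]].
  have [[z [_ z_uniq]] _] := Z0 B.
  rewrite -(z_uniq v) // (z_uniq (stable_class (linear_zero Z B))) //.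
  rewrite -[u]stable_reprK /= stable_compE => /stable_classP; apply: factors_ext => a /=.
  by rewrite subr0.
exists P; first exact: zero_object_projective.
exists (stable_class u), (stable_class v); rewrite /= stable_compE.
by congr stable_class; apply: linear_eq.
Qed.
End ZeroMorphism.

Lemma is_kernel_ker A B (f : {linear A -> B}) :
  is_kernel (f : hom (Mod R) A B) (ker f : hom (Mod R) (Ker f) A).
Proof.
split=> [|X x /zero_morphism_Mod fx].
  by apply/zero_morphism_Mod => a; apply: ker0.
have [|u uE] := @linear_lift_inj _ _ _ _ (ker f) x (@ker_inj _ _ _ f).
  by move=> a; apply: kerE; apply: fx.
exists u; split=> [|v vE]; first exact: linear_eq.
apply: linear_eq => a; apply: ker_inj; rewrite uE.
by rewrite -[x]vE.
Qed.

(** * Stable monomorphisms and kernels *)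

Section StableMonos.
Hypothesis H : forall A B (f : {linear A -> B}),
  injective f -> monic (fmap (stableQ R) f).

Lemma subprojective_of_monos : subprojective_hereditary R.
Proof.
move=> S P j projP j_inj; apply/factors_idP.
(* Monicity is tested on the identity of [S], whose composite with [j] ends in a projective
   module. *)
by have /stable_monicP := H j_inj; apply; apply: factors_projectiver.
Qed.
End StableMonos.

Section Hereditary.
Hypothesis H : subprojective_hereditary R.

(** [Im u] is projective, and [v] sends [u x] to [g (y x)], so [v] on [Im u] lifts along [g]. The
    difference of [y] and [z] is then killed by [g]. *)
Lemma stable_lift X A B (g : {linear A -> B}) (y : {linear X -> A}) :
  factors_through_projective (g \o y) ->
  exists2 z : {linear X -> A}, factors_through_projective z &
    forall x, g (z x) = g (y x).
Proof.
case=> P projP [u [v uvE]].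
pose w := corestriction u; pose k : {linear Im u -> P} := \val.
have projI : projective (Im u) by apply: (H (j := k)) => //; apply: val_inj.
have [|q qE] := projective_lift (g := g) (h := v \o k) projI.
  move=> [i iI]; have /asboolP[x xE] := iI.
  by exists (y x); rewrite -[LHS]/((g \o y) x) uvE xE.
exists (q \o w); last by move=> x; rewrite -[RHS]/((g \o y) x) uvE /= qE.
exact/factors_compr/factors_projectivel.
Qed.

Lemma stable_monic_ker A B (f : {linear A -> B}) :
  projective (Ker f) -> monic (fmap (stableQ R) f).
Proof.
move=> projK; apply/stable_monicP => X x /stable_lift[z fz zE].
have [|u uE] := @linear_lift_inj _ _ _ _ (ker f) (x \- z) (@ker_inj _ _ _ f).
  by move=> a; apply: kerE; rewrite /= linearB zE subrr.
have fu : factors_through_projective (ker f \o u).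
  exact/factors_compl/factors_projectiver.
(* The difference of [x] and [z] passes through the projective [Ker f]; [x] is recovered by two
   subtractions. *)
apply: factors_ext (factorsB fu (factorsB (factors0 (f := \0) _) fz)) => //.
by move=> a; rewrite -[LHS]/(ker f (u a) - (0 - z a)) uE sub0r opprK /= subrK.
Qed.

Lemma stable_monic_inj A B (f : {linear A -> B}) :
  injective f -> monic (fmap (stableQ R) f).
Proof. by move=> f_inj; apply/stable_monic_ker/projective_ker_inj. Qed.

(** Since [ker f] is injective, so is the first map of any factorization of it. *)
Lemma projective_ker_factors A B (f : {linear A -> B}) :
  factors_through_projective (ker f) -> projective (Ker f).
Proof.
case=> P projP [u [v uvE]]; apply: (H (j := u)) => //.
by move=> a b uab; apply: ker_inj; rewrite !uvE uab.
Qed.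

(** The existence half of the universal property of a stable kernel; uniqueness comes from
    [stable_monic_inj]. *)
Lemma stable_kernel X A B K (g : {linear A -> B}) (k : {linear K -> A})
    (y : {linear X -> A}) :
  injective k -> (forall a, g a = 0 -> exists b, k b = a) ->
  factors_through_projective (g \o y) ->
  exists u : {linear X -> K}, stable_class (k \o u) = stable_class y.
Proof.
move=> k_inj kg /stable_lift[z fz zE].
have [|u uE] := linear_lift_inj (x := y \- z) k_inj.
  by move=> a; apply: kg; rewrite /= linearB zE subrr.
exists u; apply/esym/stable_classP; apply: factors_ext fz => a.
by rewrite -[RHS]/(y a - k (u a)) uE /= opprB addrC subrK.
Qed.

End Hereditary.
End StableHom.

(** * Kernels and finite limits *)

Section ParallelPair.

(* [false] and [true] are the source and the target of the two arrows. *)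
Definition ppair_hom (i j : bool) : finType :=
  match i, j with
  | false, true => bool
  | true, false => void
  | _, _ => unit
  end.

Definition ppair_id (i : bool) : ppair_hom i i :=
  if i is true then tt else tt.

Definition ppair_comp (i j k : bool) :
    ppair_hom j k -> ppair_hom i j -> ppair_hom i k :=
  match i, j, k with
  | false, false, false => fun _ _ => tt
  | false, false, true => fun g _ => g
  | false, true, true => fun _ f => f
  | true, true, true => fun _ _ => tt
  | false, true, false => fun g _ => match g with end
  | true, true, false => fun g _ => g
  | true, false, false => fun _ f => f
  | true, false, true => fun _ f => match f with end
  end.

Lemma ppair_comp1m i j (f : ppair_hom i j) : ppair_comp (ppair_id j) f = f.
Proof. by case: i j f => [] []; case. Qed.

Lemma ppair_compm1 i j (f : ppair_hom i j) : ppair_comp f (ppair_id i) = f.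
Proof. by case: i j f => [] []; case. Qed.

Lemma ppair_compmA i j k l (h : ppair_hom k l) (g : ppair_hom j k)
    (f : ppair_hom i j) :
  ppair_comp h (ppair_comp g f) = ppair_comp (ppair_comp h g) f.
Proof.
by case: i f => [] f; case: j f g => [] f g; case: k g h => [] g h;
  case: l h => [] h //=; case: f; case: g; case: h.
Qed.

Definition ppair : fincategory :=
  FinCategory ppair_comp1m ppair_compm1 ppair_compmA.

Variables (R : pzRingType) (A B : lmodType R) (f g : {linear A -> B}).

Definition ppair_obj (i : bool) : lmodType R := if i then B else A.

Definition ppair_map (i j : bool) :
    ppair_hom i j -> {linear ppair_obj i -> ppair_obj j} :=
  match i, j with
  | false, false => fun=> idfun
  | false, true => fun u : bool => if u then f else g
  | true, true => fun=> idfun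
  | true, false => fun u => match u with end
  end.

Definition ppair_functor : functor ppair (Mod R).
Proof.
refine (@Functor ppair (Mod R) ppair_obj ppair_map _ _); first by case.
by move=> [] [] [] [] [] //=; exact: linear_eq.
Defined.

End ParallelPair.

Section Equalizer.
Variables (R : pzRingType) (A B : lmodType R) (f : {linear A -> B}).

Definition ker_leg (i : ppair) :
    {linear Ker f -> @ppair_obj R A B i} :=
  match i with true => linear_zero (Ker f) B | false => ker f end.

(** The kernel as the equalizer of [f] and the zero map. *)
Definition ker_cone : cone (ppair_functor f (linear_zero A B)).
Proof.
refine (@Cone ppair (Mod R) (ppair_functor f (linear_zero A B)) (Ker f)
  ker_leg _).
move=> [] [] [] //=; apply: linear_eq => a //=.
exact: ker0.
Defined.

Lemma ker_cone_limit : is_limit ker_cone.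
Proof.
move=> c.
(* Both arrows send the source leg to the same target leg, and one of them is zero. *)
have c0 a : f (leg c false a) = 0.
  have := legE c (true : hom ppair false true).
  have <- := legE c (false : hom ppair false true).
  exact: (congr1 (fun h : {linear _ -> _} => h a)).
have c1 : leg c true = linear_zero (apex c) B.
  have <- := legE c (false : hom ppair false true).
  exact: linear_eq.
have [|u uE] := @linear_lift_inj _ _ _ _ (ker f) (leg c false)
  (@ker_inj _ _ _ f).
  by move=> a; apply: kerE.
exists u; split=> [[]|v vE].
- by rewrite c1; apply: linear_eq.
- exact: linear_eq.
apply: linear_eq => a; apply: ker_inj; rewrite uE.
by rewrite -(vE false).
Qed.

(** Since [f \o x] is stably zero, [x] and the zero map form a cone over the diagram in the stable
    category. *)
Lemma ker_limit_factors (X : lmodType R) (x : {linear X -> A}) :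
  is_limit (map_cone (stableQ R) ker_cone) ->
  factors_through_projective (f \o x) ->
  exists u : {linear X -> Ker f}, stable_class (ker f \o u) = stable_class x.
Proof.
move=> lim fx.
pose xleg (i : ppair) : stable_hom X (@ppair_obj R A B i) :=
  match i with
  | true => stable_class (linear_zero X B)
  | false => stable_class x
  end.
pose D := fcomp (stableQ R) (ppair_functor f (linear_zero A B)).
have xlegE (i j : ppair) (u : hom ppair i j) :
    stable_comp (fmap D u) (xleg i) = xleg j.
  case: i j u => [] [] [] /=; rewrite stable_compE; apply/stable_classP.
  - by apply: factors0 => a /=; rewrite subrr.
  - by apply: factors_ext fx => a /=; rewrite subr0.
  - by apply: factors0 => a /=; rewrite subrr.
  - by apply: factors0 => a /=; rewrite subrr.
have [u [uE _]] := lim (@Cone ppair (StMod R) D X xleg xlegE).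
exists (stable_repr u); rewrite -stable_compE stable_reprK.
exact: uE false.
Qed.
End Equalizer.

(** * Preservation of finite limits *)

Section FiniteLimits.
Variables (R : pzRingType) (J : fincategory) (G : functor J (Mod R)).
Variable c : cone G.
Hypothesis c_lim : is_limit c.

Let M (j : fin_obj J) : lmodType R := G j.
Let L : lmodType R := apex c.
Let p (j : fin_obj J) : {linear L -> M j} := leg c j.

Lemma limit_factor (X : lmodType R) (x : forall j, {linear X -> M j}) :
  (forall i j (u : fin_hom i j) a, fmap G (u : hom J i j) (x i a) = x j a) ->
  exists u : {linear X -> L}, forall j a, p j (u a) = x j a.
Proof.
move=> xE.
have xE' i j (u : hom J i j) :
    Defs.comp (fmap G u) (x i : hom (Mod R) X (G i)) = x j.
  by apply: (@linear_eq _ X (M j)) => a; apply: xE.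
have [u [uE _]] := c_lim (@Cone J (Mod R) G X x xE').
exists u => j a.
exact: (congr1 (fun h : {linear X -> M j} => h a) (uE j)).
Qed.

(** The inclusion of [Ker l] in [L] and the zero map have the same composites with the legs, so
    uniqueness identifies them. *)
Lemma limit_legs_inj : exists2 l : {linear L -> dprod M},
  injective l & forall a j, l a j = p j a.
Proof.
have [l lE] := dprod_pair p; exists l => //; apply: linear_inj => a la.
have [k <-] := kerE la.
pose x j : {linear Ker l -> M j} := p j \o ker l.
have xE i j (u : hom J i j) :
    Defs.comp (fmap G u) (x i : hom (Mod R) _ (G i)) = x j.
  apply: (@linear_eq _ (Ker l) (M j)) => b.
  exact: (congr1 (fun h : {linear L -> M j} => h (ker l b)) (legE c u)).
have [v [vE v_uniq]] := c_lim (@Cone J (Mod R) G (Ker l) x xE).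
have kv : v = ker l by apply: v_uniq.
rewrite -kv (v_uniq (linear_zero _ _)) // => j; apply: linear_eq => b.
by rewrite -[LHS]/(p j 0) linear0 -[RHS]/(p j (ker l b)) -lE ker0.
Qed.

Hypothesis H : subprojective_hereditary R.

(** Representatives of a stable cone commute only up to maps through projectives. Correcting them by
    [stable_lift] gives a genuine cone, hence existence; uniqueness comes from embedding [L] in the
    product of the objects. *)
Lemma stable_limit : is_limit (map_cone (stableQ R) c).
Proof.
move=> c'; pose X : lmodType R := apex c'.
pose x (j : fin_obj J) : {linear X -> M j} := stable_repr (leg c' j).
have xE i j (u : fin_hom i j) : factors_through_projective
    ((fmap G (u : hom J i j) : {linear M i -> M j}) \o x i \- x j).
  apply/stable_classP; rewrite stable_reprK -stable_compE stable_reprK.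
  exact: legE c' _ _ u.
have /fin_all_exists[pr prE] := @dprod_proj R _ M.
(* [U] is the finite type of all arrows of [J]; the map [d] below records for each arrow how far a
   tuple is from commuting with it. *)
pose U := {ij : fin_obj J * fin_obj J & fin_hom ij.1 ij.2}.
pose e (u : U) : {linear M (tag u).1 -> M (tag u).2} :=
  fmap G (tagged u : hom J (tag u).1 (tag u).2).
have [xx xxE] := dprod_pair x.
have [d dE] := dprod_pair (fun u : U => e u \o pr (tag u).1 \- pr (tag u).2).
have [] := @stable_lift _ H _ _ _ d xx.
  apply: (dprod_factors (p := fun u : U => e u \o x (tag u).1 \- x (tag u).2)).
    by move=> a u; rewrite /= dE /= !prE !xxE.
  by move=> u; apply: xE.
move=> z fz zE.
have [|w wE] := @limit_factor X (fun j => pr j \o (xx \- z)).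
  move=> i j u a; apply: subr0_eq.
  pose uu : U := @existT (_ * _) (fun ij => fin_hom ij.1 ij.2) (i, j) u.
  have := dE (xx a - z a) uu.
  by rewrite linearB zE subrr => /esym.
have uE j : stable_comp (stable_class (p j)) (stable_class w) = leg c' j.
  rewrite stable_compE -[RHS]stable_reprK; apply/esym/stable_classP.
  apply: factors_ext (factors_compl (pr j) fz) => a.
  by rewrite /= wE /= linearB !prE xxE opprB addrC subrK.
exists (stable_class w); split=> // v vE.
rewrite -[v]stable_reprK; apply/stable_classP; set v' := stable_repr v.
(* [l] is injective, hence stably monic, and its components are fixed by the legs. *)
have [l l_inj lE] := limit_legs_inj.
have /stable_monicP := stable_monic_inj H l_inj; apply.
apply: (dprod_factors (p := fun j => p j \o (w \- v'))) => [a j|j].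
  exact: lE.
have /stable_classP : stable_class (p j \o w) = stable_class (p j \o v').
  by rewrite -!stable_compE uE stable_reprK -[LHS](vE j).
by apply: factors_ext => a /=; rewrite linearB.
Qed.
End FiniteLimits.

(** * Left heredity compared with each condition *)

Section Equivalences.
Variable R : pzRingType.

Lemma left_hereditary_subprojective :
  left_hereditary R <-> subprojective_hereditary R.
Proof.
split=> [hered S P j|H I]; first exact: hereditary_projective_sub.
apply: (H _ _ (\val : {linear submodule I -> R^o})); last exact: val_inj.
(* [R^o] is projective: a preimage [a] of [f 1] determines the lift [r *: a]. *)
move=> A B p f p_surj; have [a aE] := p_surj (f 1).
have [|g gE] := @linear_pack R R^o A (fun r : R => r *: a).
  by move=> r s t; rewrite scalerDl scalerA.
exists g => r; rewrite gE linearZ /= aE -linearZ.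
by congr (f _); apply: mulr1.
Qed.

Lemma hereditary_factors_corestriction : left_hereditary R <->
  forall (A B : lmodType R) (f : {linear A -> B}),
    factors_through_projective f <->
    factors_through_projective (corestriction f).
Proof.
rewrite left_hereditary_subprojective; split=> [H A B f|H S P j projP j_inj].
  split=> [fP|]; last first.
    move/(factors_compl (\val : {linear Im f -> B})).
    exact: factors_ext.
  (* Lifting the identity gives a [z] through a projective with [f \o z] equal to [f]; then the
     corestriction also absorbs [z]. *)
  have [z [Q projQ [u [v zE]]] fE] := @stable_lift _ H A A B f idfun fP.
  have f1 : factors_through_projective (corestriction f \o v \o u).
    by apply/factors_compr/factors_projectivel.
  apply: factors_ext f1 => a; apply: val_inj.
  by rewrite -[LHS]/(f (v (u a))) -zE fE.
(* [r] inverts [j] on its image, so [r \o corestriction j] is the identity of [S]. *)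
have [|r rE] := @linear_lift_inj _ _ _ _ j (\val : {linear Im j -> P}) j_inj.
  by case=> b bI; have /asboolP[a aE] := bI; exists a; rewrite aE.
apply/factors_idP.
have /(H _ _ j)/(factors_compl r) := factors_projectiver j projP.
apply: factors_ext => a; apply: j_inj.
by rewrite -[LHS]/(j (r (corestriction j a))) rE.
Qed.

Lemma hereditary_preserves_monos :
  left_hereditary R <-> preserves_monos (stableQ R).
Proof.
rewrite left_hereditary_subprojective; split=> [H A B f|H].
  by move=> /monic_injective; apply: stable_monic_inj.
by apply: subprojective_of_monos => A B f /monic_injective/H.
Qed.

Lemma hereditary_monic_ker_factors : left_hereditary R <->
  forall (A B : lmodType R) (f : {linear A -> B}),
    monic (fmap (stableQ R) f) <-> factors_through_projective (ker f).
Proof.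
rewrite left_hereditary_subprojective; split=> [H A B f|H].
  split=> [/stable_monicP|]; last first.
    by move/(projective_ker_factors H); apply: stable_monic_ker.
  by apply; apply: factors0 => a; apply: ker0.
apply: subprojective_of_monos => A B f f_inj.
by apply/H/factors_projectivel/projective_ker_inj.
Qed.

Lemma hereditary_monic_projective_ker : left_hereditary R <->
  forall (A B : lmodType R) (f : {linear A -> B}),
    monic (fmap (stableQ R) f) <-> projective (Ker f).
Proof.
split=> [hered A B f|H].
  have /left_hereditary_subprojective H := hered.
  have /hereditary_monic_ker_factors -> := hered.
  by split=> [|/factors_projectivel //]; apply: projective_ker_factors.
apply/left_hereditary_subprojective/subprojective_of_monos => A B f f_inj.
by apply/H/projective_ker_inj.
Qed.

Lemma factors_stable (A B : lmodType R) (f g : {linear A -> B}) :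
  stable_class f = stable_class g ->
  factors_through_projective f -> factors_through_projective g.
Proof.
move=> /stable_classP fg fP; apply: factors_ext (factorsB fP fg) => a /=.
by rewrite opprB addrC subrK.
Qed.

Lemma hereditary_left_exact :
  left_hereditary R <-> forall X : lmodType R, left_exact (stable_h X).
Proof.
have zeroP (A B : lmodType R) (f : {linear A -> B}) :
    stable_class f = 0 <-> factors_through_projective f.
  rewrite -[0](subrr (stable_class f)) -stable_classB.
  split=> [/stable_classP|fP]; last apply/stable_classP.
    by apply: factors_ext => a /=; rewrite subrr subr0.
  by apply: factors_ext fP => a /=; rewrite subrr subr0.
rewrite left_hereditary_subprojective; split=> [H X A B C f g f_inj fg|H].
  split=> [|y]; first by move=> u v; apply: (stable_monic_inj H f_inj).
  rewrite -[y]stable_reprK; set y' := stable_repr y; split=> [|[x xE]].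
    rewrite /= stable_compE => /zeroP gy.
    have [|u uE] := stable_kernel H f_inj _ gy; first by move=> b /fg.
    by exists (stable_class u); rewrite /= stable_compE.
  rewrite -xE -[x]stable_reprK -[LHS]/(stable_comp (stable_class g)
    (stable_comp (stable_class f) (stable_class (stable_repr x)))).
  rewrite (stable_compE f) stable_compE; apply/zeroP/factors0 => a /=.
  by apply/fg; exists (stable_repr x a).
apply: subprojective_of_monos => A B f f_inj.
apply/stable_monicP => X x fx.
(* Exactness at A of 0 -> A -> B; no cokernel of f is needed. *)
pose Z := Ker (idfun : {linear A -> A}).
have [||_ /(_ (stable_class x))[+ _]] := H X Z A B (linear_zero Z A) f.
- by move=> a b _; apply: ker_inj; rewrite [ker _ a](ker0 a) [ker _ b](ker0 b).
- move=> a; split=> [fa|[b <-]]; last by rewrite linear0.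
  by exists 0; rewrite linear0; apply: f_inj; rewrite fa linear0.
rewrite /= stable_compE => /(_ _)[|u]; first by apply/zeroP.
rewrite -[u]stable_reprK stable_compE => /factors_stable; apply.
exact/factors_compr/factors0.
Qed.

Lemma hereditary_preserves_kernels :
  left_hereditary R <-> preserves_kernels (stableQ R).
Proof.
rewrite left_hereditary_subprojective; split=> [H A B K f k f_ker|H].
  have [/zero_morphism_Mod fk k_univ] := f_ker.
  (* Uniqueness in the universal property makes a kernel monic. *)
  have k_inj : injective k.
    apply/monic_injective => X u v kuv.
    have [|w [_ w_uniq]] := k_univ X (Defs.comp k u).
      by apply/zero_morphism_Mod => a /=; apply: fk.
    by rewrite -(w_uniq u) // (w_uniq v).
  split=> [|X x].
    rewrite /= stable_compE; apply/zero_morphism_StMod/factors0 => a.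
    exact: fk.
  rewrite -[x]stable_reprK /= stable_compE => /zero_morphism_StMod fx.
  have [|u uE] := stable_kernel H k_inj _ fx.
    (* [ker f] factors through [k], so the zeros of [f] lie in the image of [k]. *)
    move=> a /kerE[b <-].
    have [|u [uE _]] := k_univ (Ker f) (ker f).
      by apply/zero_morphism_Mod => d; apply: ker0.
    by exists (u b); rewrite -uE.
  exists (stable_class u); split=> [|v vE]; first by rewrite stable_compE.
  by apply: (stable_monic_inj H k_inj); rewrite /= stable_compE uE vE.
apply: subprojective_of_monos => A B f f_inj; apply/stable_monicP => X x fx.
have [_ /(_ X (stable_class x))[]] := H A B (Ker f) f (ker f) (is_kernel_ker f).
  by rewrite /= stable_compE; apply/zero_morphism_StMod.
(* Stably, [x] factors through [Ker f], which is projective because [f] is injective. *)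
move=> u [+ _]; rewrite -[u]stable_reprK /= stable_compE => /factors_stable.
by apply; apply/factors_compl/factors_projectiver/projective_ker_inj.
Qed.

Lemma hereditary_preserves_finite_limits :
  left_hereditary R <-> preserves_finite_limits (stableQ R).
Proof.
rewrite left_hereditary_subprojective; split=> [H J G c c_lim|H].
  exact: stable_limit.
apply: subprojective_of_monos => A B f f_inj; apply/stable_monicP => X x fx.
have lim := H _ _ _ (ker_cone_limit (f := f)).
have [u /factors_stable] := ker_limit_factors lim fx.
by apply; apply/factors_compl/factors_projectiver/projective_ker_inj.
Qed.
End Equivalences.

Theorem theorem4p10 (Lambda : pzRingType) :
  [<-> left_hereditary Lambda;
       forall (A B : lmodType Lambda) (f : {linear A -> B}),
         factors_through_projective f <->
         factors_through_projective (corestriction f);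
       forall (A B : lmodType Lambda) (f : {linear A -> B}),
         monic (fmap (stableQ Lambda) f) <->
         factors_through_projective (ker f);
       forall (A B : lmodType Lambda) (f : {linear A -> B}),
         monic (fmap (stableQ Lambda) f) <-> projective (Ker f);
       preserves_monos (stableQ Lambda);
       forall X : lmodType Lambda, left_exact (stable_h X);
       preserves_kernels (stableQ Lambda);
       preserves_finite_limits (stableQ Lambda)].
Proof.
(* Each condition is compared with heredity alone, so consecutive implications pass through it. *)
have step (P Q : Prop) :
    (left_hereditary Lambda <-> P) -> (left_hereditary Lambda <-> Q) -> P -> Q.
  by move=> [_ hered] [hQ _] /hered/hQ.
tfae.
- exact: (hereditary_factors_corestriction Lambda).1.
- exact: step (hereditary_factors_corestriction Lambda)
    (hereditary_monic_ker_factors Lambda).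
- exact: step (hereditary_monic_ker_factors Lambda)
    (hereditary_monic_projective_ker Lambda).
- exact: step (hereditary_monic_projective_ker Lambda)
    (hereditary_preserves_monos Lambda).
- exact: step (hereditary_preserves_monos Lambda)
    (hereditary_left_exact Lambda).
- exact: step (hereditary_left_exact Lambda)
    (hereditary_preserves_kernels Lambda).
- exact: step (hereditary_preserves_kernels Lambda)
    (hereditary_preserves_finite_limits Lambda).
- exact: (hereditary_preserves_finite_limits Lambda).2.
Qed.
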